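(* Let $(\mathrm{Enc},\mathrm{Dec})$ be a quantum tamper-detection code on $t$ shares that is $\varepsilon$-secure against $\mathsf{LO}^t$. Then it is single-share encrypting with error at most $4\sqrt{\varepsilon}$: for all message states $\psi_0,\psi_1$ and every $i\in[t]$, $\|\mathrm{Tr}_{\neg i}\mathrm{Enc}(\psi_0)-\mathrm{Tr}_{\neg i}\mathrm{Enc}(\psi_1)\|_1\le 4\sqrt{\varepsilon}$.
   Context: A quantum code on $t$ shares: CPTP maps $\mathrm{Enc}:\mathcal L(\mathcal H_M)\to\mathcal L(\mathcal H_{X_1}\otimes\cdots\otimes\mathcal H_{X_t})$ and $\mathrm{Dec}$ (which may output a state $\bot$ orthogonal to $\mathcal H_M$), with $\mathrm{Dec}\circ\mathrm{Enc}=\mathrm{id}$. $\mathsf{LO}^t$: channels $\Lambda_1\otimes\cdots\otimes\Lambda_t$ with $\Lambda_i$ CPTP on share $i$. $\varepsilon$-secure tamper detection against $\mathsf{LO}^t$: for every $\Lambda\in\mathsf{LO}^t$ there is $p_\Lambda\in[0,1]$ depending only on $\Lambda$ such that for every $\sigma_M$ with canonical purification $\sigma_{M\hat M}$, $\|(\mathrm{Dec}\circ\Lambda\circ\mathrm{Enc}\otimes\mathrm{id})(\sigma_{M\hat M})-(p_\Lambda\sigma_{M\hat M}+(1-p_\Lambda)\bot\otimes\sigma_{\hat M})\|_1\le\varepsilon$. $\mathrm{Tr}_{\neg i}$ denotes tracing out all shares except the $i$-th. *)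

(* Defs.v *)
From HB Require Import structures.
From mathcomp Require Import all_boot all_order all_algebra.
From mathcomp Require Import complex.
From mathcomp Require Import reals.
From Stdlib Require Import ClassicalEpsilon.
Set Implicit Arguments. Unset Strict Implicit. Unset Printing Implicit Defensive.
Import Order.TTheory GRing.Theory Num.Theory.
Local Open Scope ring_scope.

Section QDefs.
Variable R : realType.
Local Notation C := (R[i]).

(* Operators (matrices) on the Hilbert space with orthonormal basis indexed by
   a finite type T: functions T -> T -> C. *)
Definition prodF (T A : finType) : finType := Finite.clone _ (T * A)%type.
Definition optF (T : finType) : finType := Finite.clone _ (option T).

Definition op (T : finType) := T -> T -> C.

Definition op0 {T : finType} : op T := fun _ _ => 0.
Definition opD {T : finType} (A B : op T) : op T := fun x y => A x y + B x y.
Definition opN {T : finType} (A : op T) : op T := fun x y => - A x y.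
Definition opZ {T : finType} (a : C) (A : op T) : op T := fun x y => a * A x y.
Definition opM {T : finType} (A B : op T) : op T :=
  fun x y => \sum_(z : T) A x z * B z y.
Definition adj {T : finType} (A : op T) : op T := fun x y => (A y x)^*.
Definition tr {T : finType} (A : op T) : C := \sum_(x : T) A x x.

Definition psd {T : finType} (A : op T) : Prop :=
  forall v : T -> C, 0 <= \sum_(x : T) \sum_(y : T) (v x)^* * A x y * v y.

Definition state {T : finType} (A : op T) : Prop := psd A /\ tr A = 1.

Definition psd_sqrt {T : finType} (A : op T) : op T :=
  epsilon (inhabits op0) (fun P => psd P /\ opM P P = A).

Definition tnorm {T : finType} (A : op T) : R :=
  complex.Re (tr (psd_sqrt (opM (adj A) A))).

Definition qmap (T U : finType) := op T -> op U.

Definition linear_map {T U : finType} (Phi : qmap T U) : Prop :=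
  forall (a : C) (A B : op T), Phi (opD (opZ a A) B) = opD (opZ a (Phi A)) (Phi B).

Definition tens_id {T U A : finType} (Phi : qmap T U) : qmap (prodF T A) (prodF U A) :=
  fun rho uu vv => Phi (fun t t' => rho (t, uu.2) (t', vv.2)) uu.1 vv.1.

Definition completely_positive {T U : finType} (Phi : qmap T U) : Prop :=
  forall (n : nat) (rho : op (prodF T 'I_n)), psd rho -> psd (tens_id Phi rho).

Definition trace_preserving {T U : finType} (Phi : qmap T U) : Prop :=
  forall rho : op T, tr (Phi rho) = tr rho.

Definition CPTP {T U : finType} (Phi : qmap T U) : Prop :=
  [/\ linear_map Phi, completely_positive Phi & trace_preserving Phi].

Definition unit_op {T : finType} (a b : T) : op T :=
  fun x y => if (x == a) && (y == b) then 1 else 0.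

(* t shares; share i has basis type S i; joint basis: tuples of basis elements *)
Definition joint (t : nat) (S : 'I_t -> finType) : finType :=
  {dffun forall i : 'I_t, S i}.

(* Tensor product Lambda_1 (x) ... (x) Lambda_t of maps on the individual shares:
   the linear map sending |a><b| to (x)_i Lambda_i(|a_i><b_i|). *)
Definition tens_maps (t : nat) (S : 'I_t -> finType)
    (Lam : forall i : 'I_t, qmap (S i) (S i)) : qmap (joint S) (joint S) :=
  fun rho x y => \sum_(a : joint S) \sum_(b : joint S)
    rho a b * \prod_(i : 'I_t) Lam i (unit_op (a i) (b i)) (x i) (y i).

Definition ptrace_but (t : nat) (S : 'I_t -> finType) (i : 'I_t)
    (rho : op (joint S)) : op (S i) :=
  fun a b => \sum_(x : joint S | x i == a)
             \sum_(y : joint S | (y i == b) && [forall j, (j != i) ==> (x j == y j)])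
               rho x y.

Definition ptrace2 {T A : finType} (rho : op (prodF T A)) : op T :=
  fun x y => \sum_(a : A) rho (x, a) (y, a).
Definition ptrace1 {T A : finType} (rho : op (prodF T A)) : op A :=
  fun a b => \sum_(x : T) rho (x, a) (x, b).

(* Decoder output space H_M (+) C|bot>: basis option M, None = bot *)
Definition embed {T : finType} (A : op T) : op (optF T) :=
  fun x y => match x, y with Some x', Some y' => A x' y' | _, _ => 0 end.
Definition embed1 {T A : finType} (rho : op (prodF T A)) : op (prodF (optF T) A) :=
  fun xa yb => match xa.1, yb.1 with
               | Some x, Some y => rho (x, xa.2) (y, yb.2) | _, _ => 0 end.
Definition bot_tens {T A : finType} (tau : op A) : op (prodF (optF T) A) :=
  fun xa yb => match xa.1, yb.1 with
               | None, None => tau xa.2 yb.2 | _, _ => 0 end.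

(* canonical purification of sigma on M (x) M^ with M^ a copy of M:
   |sigma> = sum_j (sqrt(sigma) |j>) (x) |j> *)
Definition canon_purif {T : finType} (sigma : op T) : op (prodF T T) :=
  let P := psd_sqrt sigma in
  fun xa yb => P xa.1 xa.2 * (P yb.1 yb.2)^*.

Definition quantum_code (M : finType) (t : nat) (S : 'I_t -> finType)
    (Enc : qmap M (joint S)) (Dec : qmap (joint S) (optF M)) : Prop :=
  [/\ CPTP Enc, CPTP Dec & forall rho : op M, Dec (Enc rho) = embed rho].

Definition tamper_detection_LO (M : finType) (t : nat) (S : 'I_t -> finType)
    (Enc : qmap M (joint S)) (Dec : qmap (joint S) (optF M)) (eps : R) : Prop :=
  forall Lam : forall i : 'I_t, qmap (S i) (S i),
    (forall i, CPTP (Lam i)) ->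
    exists p : R, 0 <= p <= 1 /\
      forall sigma : op M, state sigma ->
        let sMM := canon_purif sigma in
        tnorm (opD (tens_id (fun rho => Dec (tens_maps Lam (Enc rho))) sMM)
                   (opN (opD (opZ (p%:C)%C (embed1 sMM))
                             (opZ ((1 - p)%:C)%C (bot_tens (ptrace1 sMM))))))
          <= eps.

End QDefs.
Arguments ptrace_but {R t S} i rho.

(* Main.v *)
(** A Hermitian [X] has trace norm [tr (U X)] for a unitary [U], so let [U] be
    such a unitary for the difference of the two reduced encodings, and tamper with
    share [i] by [U]. With Kraus operators [E_k] of the encoder, [D_l] of the decoder
    and [V = U (x) 1], perfect decoding forces [D_l E_k = c_lk iota], where [iota]
    embeds the messages next to bot and [\sum |c_lk|^2 = 1]. Hence the observable
    [T = \sum_k E_k^* V E_k], which satisfies [tr (T psi) = tr (V (Enc psi))], is the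
    combination of the operators [iota^* D_l V E_k] with coefficients [conj c_lk].
    Let [s] be the purification of the equal mixture of the two messages. By security,
    the tampered decoding of [s] is close to a mixture of [s] and bot, so by the
    Cauchy-Schwarz inequality the component of [(T (x) 1) s] orthogonal to [s], whose
    squared norm is the variance of [T] in the mixture, has squared norm at most [eps].
    The squared difference of the two expectations of [T] is at most four times this
    variance, which gives the bound [2 sqrt eps]. *)
Require Import Defs.
From HB Require Import structures.
From mathcomp Require Import all_boot all_order all_algebra.
From mathcomp Require Import complex.
From mathcomp Require Import reals.
From mathcomp Require Import ring.
From Stdlib Require Import FunctionalExtensionality ClassicalEpsilon.
Set Implicit Arguments. Unset Strict Implicit. Unset Printing Implicit Defensive.
Import Order.TTheory GRing.Theory Num.Theory.
Local Open Scope ring_scope.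

(** * Vectors and operators over a finite index set *)

Section Vectors.
Variable C : numClosedFieldType.

Definition dot {T : finType} (u v : T -> C) : C := \sum_x (u x)^* * v x.
Definition app {U T : finType} (A : U -> T -> C) (v : T -> C) : U -> C :=
  fun x => \sum_a A x a * v a.
Definition adjoint {U T : finType} (A : U -> T -> C) : T -> U -> C :=
  fun a x => (A x a)^*.
Definition opcomp {U T W : finType} (A : U -> T -> C) (B : T -> W -> C) :
  U -> W -> C := fun x w => app A (B^~ w) x.

Lemma eq_dot {T : finType} (u u' v v' : T -> C) :
  u =1 u' -> v =1 v' -> dot u v = dot u' v'.
Proof. by move=> eu ev; apply: eq_bigr => x _; rewrite eu ev. Qed.

Lemma eq_app {U T : finType} (A : U -> T -> C) (v v' : T -> C) :
  v =1 v' -> app A v =1 app A v'.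
Proof. by move=> ev x; apply: eq_bigr => a _; rewrite ev. Qed.

Lemma dotC {T : finType} (u v : T -> C) : (dot u v)^* = dot v u.
Proof.
by rewrite /dot rmorph_sum; apply: eq_bigr => x _; rewrite rmorphM /= conjCK mulrC.
Qed.

Lemma dotvv {T : finType} (u : T -> C) : dot u u = \sum_x `|u x| ^+ 2.
Proof. by apply: eq_bigr => x _; rewrite normCK mulrC. Qed.

Lemma dot_ge0 {T : finType} (u : T -> C) : 0 <= dot u u.
Proof. by rewrite dotvv sumr_ge0 // => x _; rewrite exprn_ge0. Qed.

Lemma dot_linr {T : finType} (u v w : T -> C) (c : C) :
  dot u (fun x => v x + c * w x) = dot u v + c * dot u w.
Proof.
rewrite /dot mulr_sumr -big_split /=; apply: eq_bigr => x _; ring.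
Qed.

Lemma dot_linl {T : finType} (u v w : T -> C) (c : C) :
  dot (fun x => v x + c * w x) u = dot v u + c^* * dot w u.
Proof. by rewrite -dotC dot_linr rmorphD rmorphM /= !dotC. Qed.

Lemma dotZ {T : finType} (u v : T -> C) (c : C) :
  dot u (fun x => c * v x) = c * dot u v.
Proof. by rewrite /dot mulr_sumr; apply: eq_bigr => x _; ring. Qed.

Lemma dot_app {U T : finType} (A : U -> T -> C) u v :
  dot u (app A v) = dot (app (adjoint A) u) v.
Proof.
rewrite /dot /app.
under eq_bigr do rewrite mulr_sumr.
rewrite exchange_big; apply: eq_bigr => a _ /=.
rewrite rmorph_sum mulr_suml; apply: eq_bigr => x _.
by rewrite rmorphM /adjoint /= conjCK; ring.
Qed.

Lemma app_opcomp {U T W : finType} (A : U -> T -> C) (B : T -> W -> C) v :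
  app (opcomp A B) v =1 app A (app B v).
Proof.
move=> x; rewrite /app /opcomp /app.
under eq_bigr do rewrite mulr_suml.
rewrite exchange_big; apply: eq_bigr => a _ /=.
by rewrite mulr_sumr; apply: eq_bigr => b _; rewrite mulrA.
Qed.

Lemma cauchy_schwarz {T : finType} (u v : T -> C) :
  `|dot u v| ^+ 2 <= dot u u * dot v v.
Proof.
have [v0|vN0] := eqVneq (dot v v) 0.
  suff -> : dot u v = 0 by rewrite v0 mulr0 normr0 expr0n.
  move: v0; rewrite dotvv => v0; apply: big1 => x _.
  have /eqP := psumr_eq0P (fun x _ => exprn_ge0 2 (normr_ge0 (v x))) v0 (i := x) isT.
  by rewrite expf_eq0 /= normr_eq0 => /eqP ->; rewrite mulr0.
have v_gt0 : 0 < dot v v by rewrite lt_def vN0 dot_ge0.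
set c := - dot v u / dot v v.
have := dot_ge0 (fun x => u x + c * v x).
rewrite dot_linr !dot_linl /c !rmorphM !rmorphN fmorphV /= !dotC normCK dotC.
rewrite -(pmulr_lge0 _ v_gt0) => h; rewrite -subr_ge0; move: h.
by congr (0 <= _); field.
Qed.

(** Pythagoras for the component of [u] orthogonal to the unit vector [s]. *)
Lemma dot_proj {T : finType} (s u : T -> C) : dot s s = 1 ->
  dot (fun x => u x - dot s u * s x) (fun x => u x - dot s u * s x)
  = dot u u - `|dot s u| ^+ 2.
Proof.
move=> s1; transitivity (dot (fun x => u x + - dot s u * s x)
                            (fun x => u x + - dot s u * s x)).
  by apply: eq_dot => x; rewrite mulNr.
rewrite dot_linr !dot_linl !rmorphN /= !dotC s1 normCK dotC; ring.
Qed.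

(** Polarization: the form is tested on [e_x + c e_y]. The values 0, 1, -1 of [c] make the diagonal
    entries real; then 1 and ['i] make [A x y + A y x] and ['i * A x y - 'i * A y x] real. *)
Lemma real_quad {T : finType} (A : T -> T -> C) :
  (forall v, dot v (app A v) \is Num.real) -> forall x y, A y x = (A x y)^*.
Proof.
move=> hA x y.
have E (c : C) : dot (fun z => (z == x)%:R + c * (z == y)%:R)
     (app A (fun z => (z == x)%:R + c * (z == y)%:R)) =
   A x x + c * A x y + c^* * A y x + c^* * c * A y y.
  have S1 (f : T -> C) z0 : \sum_z f z * (z == z0)%:R = f z0.
    rewrite (bigD1 z0) //= eqxx mulr1 big1 ?addr0 // => z /negPf->.
    by rewrite mulr0.
  have AE z : app A (fun z => (z == x)%:R + c * (z == y)%:R) z = A z x + c * A z y.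
    rewrite /app -(S1 (A z) x) -(S1 (A z) y) mulr_sumr -big_split /=.
    by apply: eq_bigr => w _; ring.
  rewrite dot_linl (eq_dot (fun _ => erefl) AE).
  rewrite (eq_dot (u := fun z => (z == y)%:R) (fun _ => erefl) AE) /dot.
  under eq_bigr do rewrite conjC_nat mulrC.
  under [X in _ + _ * X]eq_bigr do rewrite conjC_nat mulrC.
  by rewrite !S1; ring.
have h1 := hA (fun z => (z == x)%:R + 1 * (z == y)%:R).
have hi := hA (fun z => (z == x)%:R + 'i * (z == y)%:R).
rewrite E in h1; rewrite E in hi.
have rx : A x x \is Num.real.
  have := hA (fun z => (z == x)%:R + 0 * (z == y)%:R).
  by rewrite E !mul0r conjC0 !mul0r !addr0.
have ry : A y y \is Num.real.
  have := hA (fun z => (z == x)%:R + 1 * (z == y)%:R).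
  have := hA (fun z => (z == x)%:R + (-1) * (z == y)%:R).
  rewrite !E rmorphN /= !conjC1 => /rpredD h /h.
  rewrite (_ : _ + _ = 2 * A x x + 2 * A y y); last ring.
  rewrite rpredDl; first by rewrite realMr ?realn ?pnatr_eq0.
  by rewrite realM ?realn.
have r1 : A x y + A y x \is Num.real.
  move: h1; rewrite conjC1 !mul1r rpredDr // -addrA rpredDl //.
have ri : 'i * A x y - 'i * A y x \is Num.real.
  move: hi; rewrite conjCi !mulNr -expr2 sqrCi mulN1r opprK.
  by rewrite rpredDr // -addrA rpredDl.
move/CrealP: r1; rewrite rmorphD /= => r1.
move/CrealP: ri; rewrite rmorphB /= !rmorphM /= conjCi => ri.
have {}ri : - (A x y)^* + (A y x)^* = A x y - A y x.
  apply: (mulfI (neq0Ci C)); rewrite !mulrDr !mulrN -ri; ring.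
have : 2 * A y x = 2 * (A x y)^*.
  transitivity ((A x y + A y x) - (A x y - A y x)); first by ring.
  by rewrite -r1 -ri; ring.
by apply: mulfI; rewrite pnatr_eq0.
Qed.

(** The matrix spectral theorem transported along the enumeration of [T]. Column [k] of [V] is an
    eigenvector for [d k]; completeness and orthonormality of the columns are stated separately,
    since both are used below. *)
Lemma spectral_decomposition {T : finType} (A : T -> T -> C) :
  (forall x y, A y x = (A x y)^*) ->
  exists (V : T -> T -> C) (d : T -> C),
  [/\ forall x y, A x y = \sum_k V x k * d k * (V y k)^*,
      forall x y, \sum_k V x k * (V y k)^* = (x == y)%:R,
      forall k l, \sum_x (V x k)^* * V x l = (k == l)%:R
    & forall k, d k \is Num.real].
Proof.
move=> hA.
pose M := \matrix_(i, j) A (enum_val i) (enum_val j) : 'M[C]_#|T|.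
have Mh : M \is hermsymmx.
  apply/is_hermitianmxP; rewrite expr0 scale1r; apply/matrixP => i j.
  by rewrite !mxE hA.
have /matrixP/= ME := orthomx_spectralP (hermitian_normalmx Mh).
have /mxOverP dr := hermitian_spectral_diag_real Mh.
have PU := spectral_unitarymx M.
rewrite invmx_unitary // in ME.
set P := spectralmx M in ME PU *; set d := spectral_diag M in ME dr *.
have bij (F : T -> C) : \sum_k F k = \sum_(i < #|T|) F (enum_val i).
  by rewrite (reindex (@enum_val T T)) //; apply/onW_bij/enum_val_bij.
have PP := unitarymxP PU.
have PP' : map_mx Num.conj P^T *m P = 1%:M by apply: mulmx1C.
exists (fun x k => (P (enum_rank k) (enum_rank x))^*).
exists (fun k => d 0 (enum_rank k)); split.
- move=> x y; have := ME (enum_rank x) (enum_rank y).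
  rewrite mxE !enum_rankK => ->; rewrite mul_mx_diag mxE bij.
  by apply: eq_bigr => i _; rewrite !mxE enum_valK conjCK.
- move=> x y; move/matrixP: PP' => /(_ (enum_rank x) (enum_rank y)).
  rewrite !mxE (inj_eq enum_rank_inj) => <-; rewrite bij.
  by apply: eq_bigr => i _; rewrite !mxE enum_valK conjCK.
- move=> x y; move/matrixP: PP => /(_ (enum_rank x) (enum_rank y)).
  rewrite !mxE (inj_eq enum_rank_inj) => <-; rewrite bij.
  by apply: eq_bigr => i _; rewrite !mxE enum_valK conjCK.
- by move=> k; apply: dr.
Qed.

(** Functional calculus in the eigenbasis; below, [f] is the family of eigenvalues, their square
    roots or their signs. *)
Lemma app_diag {T : finType} (V : T -> T -> C) (f : T -> C) k :
  (forall k l, \sum_x (V x k)^* * V x l = (k == l)%:R) ->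
  app (fun x y => \sum_l V x l * f l * (V y l)^*) (V^~ k)
    =1 fun x => f k * V x k.
Proof.
move=> hV x; rewrite /app; under eq_bigr do rewrite mulr_suml.
rewrite exchange_big /= (bigD1 k) //= [X in _ + X]big1 => [|l lk].
  under eq_bigr do rewrite -mulrA.
  by rewrite -mulr_sumr hV eqxx addr0; rewrite /=; ring.
under eq_bigr do rewrite -mulrA.
by rewrite -mulr_sumr hV (negPf lk) mulr0.
Qed.

(** Basis independence of the trace, by the completeness relation of the columns. *)
Lemma sum_basis {T : finType} (V : T -> T -> C) (A : T -> T -> C) :
  (forall x y, \sum_k V x k * (V y k)^* = (x == y)%:R) ->
  \sum_k dot (V^~ k) (app A (V^~ k)) = \sum_x A x x.
Proof.
move=> hV; rewrite /dot exchange_big /=; apply: eq_bigr => x _.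
rewrite /app; under eq_bigr do rewrite mulr_sumr.
rewrite exchange_big /= (bigD1 x) //= [X in _ + X]big1 => [|y yx].
  transitivity (A x x * \sum_k V x k * (V x k)^*).
    by rewrite addr0 mulr_sumr; apply: eq_bigr => k _; ring.
  by rewrite hV eqxx mulr1.
transitivity (A x y * \sum_k V y k * (V x k)^*).
  by rewrite mulr_sumr; apply: eq_bigr => k _; ring.
by rewrite hV (negPf yx) mulr0.
Qed.

End Vectors.

(** * The trace norm *)

Section Operators.
Variable R : realType.
Local Notation C := (R[i]).

Lemma op_ext (U T : Type) (A B : U -> T -> C) : (forall x y, A x y = B x y) -> A = B.
Proof.
by move=> e; do 2![apply: functional_extensionality => ?]; apply: e.
Qed.

Lemma psdP {T : finType} (A : op R T) :
  psd A <-> forall v, 0 <= dot v (app A v).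
Proof.
have E v : \sum_x \sum_y (v x)^* * A x y * v y = dot v (app A v).
  apply: eq_bigr => x _; rewrite mulr_sumr; apply: eq_bigr => y _.
  by rewrite mulrA.
by split=> h v; have := h v; rewrite E.
Qed.

Lemma psd_hermitian {T : finType} (A : op R T) :
  psd A -> forall x y, A y x = (A x y)^*.
Proof. by move/psdP => h; apply: real_quad => v; apply: ger0_real. Qed.

Lemma psd_gram {U T : finType} (B : U -> T -> C) : psd (opcomp (adjoint B) B).
Proof.
apply/psdP => v.
rewrite (eq_dot (fun _ => erefl) (app_opcomp _ _ _)) dot_app.
rewrite (eq_dot (v' := app B v) (u' := app B v)) ?dot_ge0 // => x.
by apply: eq_bigr => a _; rewrite /adjoint conjCK.
Qed.

(** As [psd_sqrt] is picked by choice, it meets its specification once some root exists; the witness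
    takes square roots of the eigenvalues. *)
Lemma psd_sqrtP {T : finType} (A : op R T) : psd A ->
  psd (psd_sqrt A) /\ opM (psd_sqrt A) (psd_sqrt A) = A.
Proof.
move=> pA.
apply: (@epsilon_spec _ _ (fun P => psd P /\ opM P P = A)).
have [V [d [AE VV' V'V dr]]] := spectral_decomposition (psd_hermitian pA).
have d0 k : 0 <= d k.
  have /psdP/(_ (V^~ k)) := pA.
  have -> : A = fun x y => \sum_k V x k * d k * (V y k)^* by apply: op_ext.
  by rewrite (eq_dot (fun _ => erefl) (app_diag _ _ V'V)) dotZ /dot V'V eqxx mulr1.
exists (fun x y => \sum_k V x k * sqrtC (d k) * (V y k)^*); split.
  apply/psdP => v.
  (* The candidate root is positive because it is the Gram operator of [B], built from fourth roots
     of the eigenvalues. *)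
  set B := fun k x => sqrtC (sqrtC (d k)) * (V x k)^*.
  have /psdP/(_ v) := psd_gram B; congr (0 <= dot _ (app _ _)).
  apply: op_ext => x y; apply: eq_bigr => k _.
  rewrite /adjoint /B rmorphM /= conjCK [(sqrtC _)^*]geC0_conj ?sqrtC_ge0 //.
  by rewrite -{3}(sqrtCK (sqrtC (d k))); ring.
apply: op_ext => x y; rewrite AE /opM.
transitivity (app (fun x y => \sum_k V x k * sqrtC (d k) * (V y k)^*)
  (fun z => \sum_k (sqrtC (d k) * (V y k)^*) * V z k) x).
  by apply: eq_bigr => z _; congr (_ * _); apply: eq_bigr => k _; ring.
rewrite /app; under eq_bigr do rewrite mulr_sumr.
rewrite exchange_big; apply: eq_bigr => k _ /=.
under eq_bigr do rewrite mulrCA.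
have := app_diag (fun k => sqrtC (d k)) k V'V x; rewrite -mulr_sumr /app => ->.
by rewrite -[in RHS](sqrtCK (d k)); ring.
Qed.

(** Diagonal entries of a positive operator are nonnegative, so the trace is real and the real part
    in [tnorm] loses nothing. *)
Lemma tnormE {T : finType} (X : op R T) :
  (tnorm X)%:C%C = tr (psd_sqrt (opM (adj X) X)) /\
  0 <= (tnorm X)%:C%C.
Proof.
have [/psdP pP _] := psd_sqrtP (psd_gram X).
suff h : 0 <= tr (psd_sqrt (opM (adj X) X)).
  by rewrite /tnorm RRe_real ?ger0_real.
apply: sumr_ge0 => x _.
have := pP (fun y => (y == x)%:R); congr (0 <= _).
rewrite /dot /app (bigD1 x) //= [X in _ + X]big1 => [|y /negPf->]; last first.
  by rewrite conjC0 mul0r.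
rewrite addr0 eqxx conjC1 mul1r (bigD1 x) //= eqxx big1 => [|y /negPf->].
  by rewrite mulr1 addr0.
by rewrite mulr0.
Qed.

(** Both sides are the quadratic form of [X^* X] at [v]. This takes the place of a polar
    decomposition. *)
Lemma dot_psd_sqrt {T : finType} (X : op R T) v :
  dot (app (psd_sqrt (opM (adj X) X)) v) (app (psd_sqrt (opM (adj X) X)) v)
  = dot (app X v) (app X v).
Proof.
have [/psd_hermitian hP PP] := psd_sqrtP (psd_gram X).
set P := psd_sqrt _ in hP PP *.
transitivity (dot v (app (opM P P) v)).
  rewrite [RHS](eq_dot (fun _ => erefl) (app_opcomp _ _ _)) [RHS]dot_app.
  apply: eq_dot => // x.
  by apply: eq_bigr => y _; rewrite /adjoint -hP.
rewrite PP (eq_dot (fun _ => erefl) (app_opcomp _ _ _)) dot_app; apply: eq_dot => // x.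
by apply: eq_bigr => y _; rewrite /adjoint /adj conjCK.
Qed.

Lemma cauchy_schwarz_le {T : finType} (u v : T -> C) (d : C) :
  dot u u <= 1 -> 0 <= d -> dot v v <= d ^+ 2 -> `|dot u v| <= d.
Proof.
move=> u1 d0 vd; rewrite -(ler_pXn2r (n := 2)) ?nnegrE //.
apply: le_trans (cauchy_schwarz _ _) _; rewrite -[leRHS]mul1r.
by apply: ler_pM; rewrite ?dot_ge0.
Qed.

(** In an eigenbasis of |X|, the [k]-th term of the trace is the inner product of [Q V_k] and
    [X V_k], at most the norm of [X V_k] since [Q] is a contraction; that norm is the [k]-th
    eigenvalue of |X|. *)
Lemma tnorm_dual {T : finType} (Q X : op R T) :
  adj Q = Q -> (forall v, dot (app Q v) (app Q v) <= dot v v) ->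
  `|tr (opM Q X)| <= (tnorm X)%:C%C.
Proof.
move=> Qh Qc; have [-> _] := tnormE X.
have [/[dup] pP /psdP P0 PP] := psd_sqrtP (psd_gram X).
have XP := dot_psd_sqrt X.
change (opM (adj X) X) with (opcomp (adjoint X) X) in *.
set P := psd_sqrt _ in P0 pP PP XP *.
have [V [d [PE VV' V'V dr]]] := spectral_decomposition (psd_hermitian pP).
have PV k : app P (V^~ k) =1 fun x => d k * V x k.
  by move=> x; rewrite -(app_diag _ _ V'V x); apply: eq_bigr => y _; rewrite PE.
have V1 k : dot (V^~ k) (V^~ k) = 1 by rewrite /dot V'V eqxx.
have dE k : dot (V^~ k) (app P (V^~ k)) = d k.
  by rewrite (eq_dot (fun _ => erefl) (PV k)) dotZ V1 mulr1.
have d0 k : 0 <= d k by rewrite -dE.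
rewrite /tr -(sum_basis _ VV') -[leRHS](sum_basis _ VV').
apply: le_trans (ler_norm_sum _ _ _) _; apply: ler_sum => k _.
rewrite dE (eq_dot (fun _ => erefl) (app_opcomp _ _ _)) dot_app.
rewrite (Qh : adjoint Q = Q); apply: cauchy_schwarz_le => //; first by rewrite -(V1 k).
rewrite -XP (eq_dot (PV k) (PV k)) dotZ -dotC dotZ V1 mulr1.
by rewrite (CrealP (dr k)) expr2.
Qed.

Lemma tnorm_hermitian_unitary {T : finType} (X : op R T) :
  (forall x y, X y x = (X x y)^*) ->
  exists2 U : op R T, (forall x y, opM (adj U) U x y = (x == y)%:R) &
  (tnorm X)%:C%C <= tr (opM U X).
Proof.
move=> Xh.
have [V [d [XE VV' V'V dr]]] := spectral_decomposition Xh.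
(* [U] will be the sign function of [X]; the value 1 at eigenvalue 0 keeps it unitary. *)
pose s k : C := if 0 <= d k then 1 else -1.
have ss k : (s k)^* * s k = 1.
  by rewrite /s; case: ifP; rewrite ?rmorphN /= ?conjC1 ?mulrNN mulr1.
have V1 k : dot (V^~ k) (V^~ k) = 1 by rewrite /dot V'V eqxx.
have XV k : app X (V^~ k) =1 fun x => d k * V x k.
  by move=> x; rewrite -(app_diag _ _ V'V x); apply: eq_bigr => y _; rewrite XE.
pose U : op R T := fun x y => \sum_k V x k * s k * (V y k)^*.
exists U.
  move=> x y.
  transitivity (app (fun x y => \sum_k V x k * (s k)^* * (V y k)^*)
    (fun z => \sum_k (s k * (V y k)^*) * V z k) x).
    apply: eq_bigr => z _; congr (_ * _).
      rewrite /adj /U rmorph_sum; apply: eq_bigr => k _ /=.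
      by rewrite !rmorphM /= conjCK; ring.
    by apply: eq_bigr => k _; ring.
  rewrite /app; under eq_bigr do rewrite mulr_sumr.
  rewrite exchange_big -VV'; apply: eq_bigr => k _ /=.
  under eq_bigr do rewrite mulrCA.
  have := app_diag (fun k => (s k)^*) k V'V x; rewrite -mulr_sumr /app => ->.
  rewrite -[RHS]mulr1 -(ss k); ring.
have [-> _] := tnormE X.
have [/[dup] pP /psdP P0 PP] := psd_sqrtP (psd_gram X).
have XP := dot_psd_sqrt X.
change (opM (adj X) X) with (opcomp (adjoint X) X) in *.
set P := psd_sqrt _ in P0 pP PP XP *.
rewrite /tr -(sum_basis _ VV') -[leRHS](sum_basis _ VV').
apply: ler_sum => k _.
have -> : dot (V^~ k) (app (opM U X) (V^~ k)) = `|d k|.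
  rewrite (eq_dot (fun _ => erefl) (app_opcomp _ _ _)).
  rewrite (eq_dot (fun _ => erefl) (eq_app _ (XV k))).
  have E : app U (fun x => d k * V x k) =1 fun x => d k * (s k * V x k).
    move=> x; rewrite -(app_diag _ _ V'V x) /app mulr_sumr.
    by apply: eq_bigr => y _; rewrite /U; ring.
  rewrite (eq_dot (fun _ => erefl) E) !dotZ V1 mulr1 /s.
  case: ifP => [/ger0_norm->|]; rewrite ?mulr1 // => /negbT.
  by rewrite -real_ltNge ?rpred0 ?dr // => /ltr0_norm->; rewrite mulrN1.
(* The basis diagonalizes [X], and Cauchy-Schwarz bounds the diagonal entry of [P] at [V_k] by the
   norm of [P V_k], which is that of [X V_k], namely |d_k|. *)
rewrite -[leLHS]ger0_norm //.
apply: cauchy_schwarz_le => //; first by rewrite V1.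
rewrite XP (eq_dot (XV k) (XV k)) dotZ -dotC dotZ V1 mulr1.
by rewrite (CrealP (dr k)) real_normK ?dr // expr2.
Qed.

End Operators.

(** * Kraus operators *)

Section Channels.
Variable R : realType.
Local Notation C := (R[i]).

Definition kraus {K T U : finType} (E : K -> U -> T -> C) (Phi : qmap R T U) :=
  forall rho x y, Phi rho x y =
    \sum_k \sum_(p : T * T) E k x p.1 * rho p.1 p.2 * (E k y p.2)^*.

Lemma sum_unit (F : unit -> C) : \sum_u F u = F tt.
Proof.
by rewrite (eq_bigr (fun=> F tt)) => [|[] //]; rewrite big_const card_unit /= addr0.
Qed.

Lemma sum_pair {A B : finType} (F : A * B -> C) :
  \sum_p F p = \sum_a \sum_b F (a, b).
Proof. by rewrite pair_bigA; apply: eq_bigr => -[]. Qed.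

Lemma linear_map_sum {T U I : finType} (Phi : qmap R T U) (c : I -> C)
    (A : I -> op R T) : linear_map Phi ->
  Phi (fun x y => \sum_i c i * A i x y) = fun x y => \sum_i c i * Phi (A i) x y.
Proof.
move=> Phil.
have Phi0 : Phi (op0 R) = op0 R.
  have e : opD (opZ (-1) (op0 R)) (op0 R) = op0 R :> op R T.
    by apply: op_ext => x y; rewrite /opD /opZ /op0; ring.
  have := Phil (-1) (op0 R) (op0 R); rewrite e => h; apply: op_ext => x y.
  by have := congr1 (fun A => A x y) h; rewrite /opD /opZ mulN1r addNr.
elim: (index_enum I) => [|i r IH].
  transitivity (Phi (op0 R)); last rewrite Phi0.
    by congr Phi; apply: op_ext => x y; rewrite big_nil.
  by apply: op_ext => x y; rewrite big_nil.
transitivity (Phi (opD (opZ (c i) (A i)) (fun x y => \sum_(j <- r) c j * A j x y))).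
  by congr Phi; apply: op_ext => x y; rewrite big_cons.
by rewrite Phil IH; apply: op_ext => x y; rewrite big_cons.
Qed.

Lemma op_unit_sum {T : finType} (A : op R T) :
  A = fun x y => \sum_(p : T * T) A p.1 p.2 * unit_op R p.1 p.2 x y.
Proof.
apply: op_ext => x y; rewrite (bigD1 (x, y)) //= /unit_op !eqxx mulr1.
rewrite big1 ?addr0 // => -[a b] /=.
by rewrite xpair_eqE [x == a]eq_sym [y == b]eq_sym => /negPf->; rewrite mulr0.
Qed.

(* The Kraus operators are the columns of a square root of the Choi matrix. *)
Lemma choi_kraus {T U : finType} (Phi : qmap R T U) :
  linear_map Phi -> completely_positive Phi ->
  exists (K : finType) (E : K -> U -> T -> C), kraus E Phi.
Proof.
move=> Phil Phicp.
(* The unnormalized maximally entangled operator, with an ordinal ancilla to match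
   [completely_positive], so that [tens_id Phi rho0] is the Choi matrix. *)
pose rho0 : op R (prodF T 'I_#|T|) := fun p q =>
  (p.1 == enum_val p.2)%:R * (q.1 == enum_val q.2)%:R.
have rho0p : psd rho0.
  pose B (u : unit) (p : prodF T 'I_#|T|) : C := (p.1 == enum_val p.2)%:R.
  have := psd_gram B; congr psd.
  apply: op_ext => p q; rewrite /opcomp /app /adjoint sum_unit.
  by rewrite /B conjC_nat.
have Jp := Phicp _ _ rho0p.
have [/psd_hermitian Ph PP] := psd_sqrtP Jp.
set P := psd_sqrt _ in Ph PP.
exists (prodF U 'I_#|T|), (fun k x a => P (x, enum_rank a) k) => rho x y.
rewrite {1}(op_unit_sum rho) linear_map_sum // exchange_big.
apply: eq_bigr => -[a b] _ /=.
transitivity (rho a b * opM P P (x, enum_rank a) (y, enum_rank b)).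
  congr (_ * _); rewrite PP /tens_id /=; congr (Phi _ x y).
  apply: op_ext => t t'; rewrite /rho0 /unit_op /= !enum_rankK.
  by rewrite -natrM mulnb; case: (_ && _).
by rewrite /opM mulr_sumr; apply: eq_bigr => k _; rewrite (Ph (y, _)); ring.
Qed.

Lemma kraus_unit {K T U : finType} (E : K -> U -> T -> C) Phi : kraus E Phi ->
  forall a b x y, Phi (unit_op R a b) x y = \sum_k E k x a * (E k y b)^*.
Proof.
move=> PE a b x y; rewrite PE; apply: eq_bigr => k _.
rewrite (bigD1 (a, b)) //= big1 => [|[c d]] /=.
  by rewrite /unit_op !eqxx mulr1 addr0.
by rewrite xpair_eqE /unit_op => /negPf->; rewrite mulr0 mul0r.
Qed.

(** The relation sum_k E_k^* E_k = 1 in terms of inner products; it is trace preservation on the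
    rank-one operator |v><u|. *)
Lemma kraus_isometry {K T U : finType} (E : K -> U -> T -> C) Phi :
  kraus E Phi -> trace_preserving Phi ->
  forall u v, \sum_k dot (app (E k) u) (app (E k) v) = dot u v.
Proof.
move=> PE tp u v.
have := tp (fun x y => v x * (u y)^*); rewrite /tr.
under [RHS]eq_bigr do rewrite mulrC.
move=> h; rewrite [RHS]/dot -[RHS]h; under [RHS]eq_bigr do rewrite PE.
rewrite exchange_big; apply: eq_bigr => k _ /=; apply: eq_bigr => x _.
rewrite mulrC /app rmorph_sum big_distrlr pair_bigA /=.
by apply: eq_bigr => p _; rewrite rmorphM /=; ring.
Qed.

Lemma kraus_comp {K L T U W : finType} (E : K -> U -> T -> C) (D : L -> W -> U -> C)
    Phi Psi : kraus E Phi -> kraus D Psi ->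
  kraus (fun f : L * K => opcomp (D f.1) (E f.2)) (fun rho => Psi (Phi rho)).
Proof.
move=> PE PD rho x y; rewrite PD sum_pair /=.
apply: eq_bigr => l _.
under eq_bigr do rewrite PE mulr_sumr mulr_suml.
rewrite exchange_big; apply: eq_bigr => k _ /=.
under eq_bigr do rewrite mulr_sumr mulr_suml.
rewrite exchange_big; apply: eq_bigr => q _ /=.
rewrite mulrAC /opcomp /app rmorph_sum big_distrlr pair_bigA /= mulr_suml.
by apply: eq_bigr => p _; rewrite rmorphM /=; ring.
Qed.

Definition conj_map {T : finType} (V : op R T) : qmap R T T :=
  fun rho => opM (opM V rho) (adj V).

Lemma conj_mapE {T : finType} (V : op R T) rho x y :
  conj_map V rho x y = \sum_(p : T * T) V x p.1 * rho p.1 p.2 * (V y p.2)^*.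
Proof.
rewrite /conj_map /opM; under eq_bigr do rewrite mulr_suml.
by rewrite exchange_big pair_bigA.
Qed.

Lemma conj_map_CPTP {T : finType} (V : op R T) :
  (forall x y, opM (adj V) V x y = (x == y)%:R) -> CPTP (conj_map V).
Proof.
move=> VV; split.
- move=> a A B; apply: op_ext => x y; rewrite /opD /opZ !conj_mapE mulr_sumr.
  by rewrite -big_split /=; apply: eq_bigr => p _; ring.
- move=> n rho /psdP rp; apply/psdP => v.
  (* The form of the output at [v] is the form of [rho] at the image of [v] under the adjoint of [V]
     tensored with the identity. *)
  have := rp (app (fun (p q : prodF T 'I_n) => (V q.1 p.1)^* * (p.2 == q.2)%:R) v).
  set A := (A in app A v).
  have -> : A = adjoint (fun q p => V q.1 p.1 * (p.2 == q.2)%:R).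
    by apply: op_ext => p q; rewrite /A /adjoint rmorphM /= conjC_nat.
  set B := (fun q p => _); rewrite -dot_app; congr (0 <= _); apply: eq_dot => // p.
  have BE w q : app B w q = \sum_a V q.1 a * w (a, q.2).
    rewrite /app sum_pair /=.
    apply: eq_bigr => a _; rewrite (bigD1 q.2) //= /B /= eqxx mulr1.
    by rewrite big1 ?addr0 // => j /negPf->; rewrite mulr0 mul0r.
  rewrite BE.
  transitivity (\sum_(q : prodF T 'I_n) conj_map V
     (fun t t' => rho (t, p.2) (t', q.2)) p.1 q.1 * v q); last by [].
  under [RHS]eq_bigr do rewrite conj_mapE mulr_suml.
  rewrite exchange_big /= sum_pair /=.
  apply: eq_bigr => a _; rewrite /app mulr_sumr.
  rewrite sum_pair /=; apply: eq_bigr => b _.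
  rewrite sum_pair /=.
  rewrite [RHS]exchange_big /=; apply: eq_bigr => j _.
  rewrite sum_pair /=.
  rewrite !mulr_sumr; apply: eq_bigr => c _.
  rewrite (bigD1 j) //= /adjoint /B /= eqxx mulr1 big1 => [|i /negPf ij].
    by rewrite addr0; ring.
  by rewrite eq_sym ij mulr0 conjC0 mul0r.
- move=> rho; rewrite /tr.
  under eq_bigr do rewrite conj_mapE.
  rewrite exchange_big sum_pair /=.
  apply: eq_bigr => a _; rewrite -[RHS]mulr1.
  have E b : \sum_x V x a * rho a b * (V x b)^* = rho a b * (b == a)%:R.
    rewrite -VV /opM mulr_sumr; apply: eq_bigr => x _; rewrite /adj; ring.
  rewrite (bigD1 a) //= E eqxx big1 ?addr0 // => b /negPf ba.
  by rewrite E ba mulr0.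
Qed.

Lemma prod_forall {I : finType} (P b : pred I) :
  \prod_(j | P j) (b j)%:R = [forall j, P j ==> b j]%:R :> C.
Proof.
case: forallP => [h|/forallP].
  by apply: big1 => j Pj; have := h j; rewrite Pj /= => ->.
rewrite negb_forall => /existsP[j]; rewrite negb_imply => /andP[Pj /negPf bj].
by rewrite (bigD1 j) //= bj mul0r.
Qed.

(** * Product operators and operators on a single share *)

Section Shares.
Variables (t : nat) (S : 'I_t -> finType).

Definition tens_op (W : forall i, op R (S i)) : op R (joint S) :=
  fun x a => \prod_i W i (x i) (a i).

(** Each factor has a single Kraus operator, so the tensor product has one too. *)
Lemma tens_maps_conj (W : forall i, op R (S i)) :
  kraus (fun _ : unit => tens_op W) (tens_maps (fun i => conj_map (W i))).
Proof.
move=> rho x y; rewrite sum_unit /tens_maps pair_bigA /=.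
apply: eq_bigr => p _; rewrite [RHS]mulrAC [RHS]mulrC; congr (_ * _).
rewrite /tens_op [X in _ * X](rmorph_prod) -big_split /=; apply: eq_bigr => i _.
have kW : kraus (fun _ : unit => W i) (conj_map (W i)).
  by move=> rho' x' y'; rewrite sum_unit conj_mapE.
by rewrite (kraus_unit kW) sum_unit.
Qed.

(** [dfwith] overrides one entry of the dependent family of identities. Keeping the product form
    makes conjugation by a unitary [U] an admissible local tampering. *)
Definition share_op (i : 'I_t) (U : op R (S i)) : op R (joint S) :=
  tens_op (dfwith (fun j => fun x y : S j => (x == y)%:R) U).

Lemma share_opE i (U : op R (S i)) x a :
  share_op U x a = U (x i) (a i) * [forall j, (j != i) ==> (x j == a j)]%:R.
Proof.
rewrite /share_op /tens_op (bigD1 i) //= dfwith_in; congr (_ * _).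
rewrite -prod_forall; apply: eq_bigr => j ji.
by rewrite dfwith_out // eq_sym.
Qed.

(** Duality between the partial trace and tensoring with the identity: it turns an observable on
    share [i] into one on the whole encoding. *)
Lemma tr_ptrace_but i (U : op R (S i)) rho :
  tr (opM U (ptrace_but i rho)) = tr (opM (share_op U) rho).
Proof.
rewrite /tr /opM /ptrace_but.
transitivity (\sum_c \sum_(x : joint S) \sum_(y : joint S | y i == c)
   share_op U y x * rho x y).
  apply: eq_bigr => c _.
  under eq_bigr do rewrite mulr_sumr.
  rewrite (exchange_big_dep xpredT) //=; apply: eq_bigr => x _.
  under eq_bigl do rewrite eq_sym.
  rewrite big_pred1_eq mulr_sumr big_mkcondr /=.
  apply: eq_bigr => y /eqP <-; rewrite share_opE.
  under eq_forallb => j do rewrite [y j == _]eq_sym.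
  by case: ifP => _; rewrite ?mulr1 ?mulr0 ?mul0r.
rewrite exchange_big [RHS]exchange_big /=; apply: eq_bigr => x _.
rewrite (exchange_big_dep xpredT) //=; apply: eq_bigr => y _.
under eq_bigl do rewrite eq_sym.
by rewrite big_pred1_eq.
Qed.

End Shares.
End Channels.

(** * The decoded tampering channel *)

Section Tampering.
Variable R : realType.
Local Notation C := (R[i]).

Lemma sum_option {T : finType} (F : option T -> C) :
  \sum_z F z = F None + \sum_x F (Some x).
Proof.
rewrite (bigD1 None) //=; congr (_ + _).
(* Inverting [Some] takes a default value, so the empty type is treated apart. *)
case: (pickP (mem T)) => [x0 _|T0].
  rewrite (reindex_onto Some (odflt x0)) => [|[] //].
  by apply: eq_bigl => x; rewrite /= eqxx.
have {}T0 (x : T) : False by have := T0 x.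
rewrite [RHS]big1 => [|x _]; last by case: (T0 x).
by rewrite big1 // => -[x|] //; case: (T0 x).
Qed.

Lemma cauchy_schwarz_sum {I T : finType} (u v : I -> T -> C) :
  `|\sum_i dot (u i) (v i)| ^+ 2 <=
  (\sum_i dot (u i) (u i)) * \sum_i dot (v i) (v i).
Proof.
have := cauchy_schwarz (fun p : I * T => u p.1 p.2) (fun p => v p.1 p.2).
by rewrite /dot !sum_pair.
Qed.

(** The products D_l E_k are Kraus operators of [embed], which is conjugation by a single isometry
    iota. Comparison on matrix units makes each product a multiple of iota, and the factor is read
    off at [a0]. *)
Lemma decoder_kraus {K L M N : finType} (E : K -> N -> M -> C)
    (D : L -> optF M -> N -> C) Enc Dec (a0 : M) :
  kraus E Enc -> kraus D Dec -> (forall rho, Dec (Enc rho) = embed rho) ->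
  exists2 c : L -> K -> C,
    forall l k z a, opcomp (D l) (E k) z a = c l k * (z == Some a)%:R &
    \sum_l \sum_k `|c l k| ^+ 2 = 1.
Proof.
move=> kE kD DE.
pose F (f : L * K) := opcomp (D f.1) (E f.2).
have FF a b z w : \sum_f F f z a * (F f w b)^* =
    (z == Some a)%:R * (w == Some b)%:R.
  rewrite -(kraus_unit (kraus_comp kE kD)) DE /embed /unit_op.
  case: z w => [z|] [w|] /=; rewrite ?mul0r ?mulr0 //.
  by rewrite -natrM mulnb !(inj_eq Some_inj); case: ifP.
(* For [z] other than [Some a], the squared moduli of the entries sum to zero over [f]. *)
have F0 f z a : z != Some a -> F f z a = 0.
  move=> za; have := FF a a z z; rewrite (negPf za) mul0r.
  under eq_bigr do rewrite -normCK.
  move/psumr_eq0P => /(_ (fun f _ => exprn_ge0 2 (normr_ge0 _)) f isT)/eqP.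
  by rewrite expf_eq0 normr_eq0 => /andP[_ /eqP].
(* The squared differences sum to 1 - 1 - 1 + 1 = 0, so the diagonal entry does not depend on
   [a]. *)
have Fc f a b : F f (Some a) a = F f (Some b) b.
  have : \sum_f `|F f (Some a) a - F f (Some b) b| ^+ 2 = 0.
    transitivity (\sum_f (F f (Some a) a * (F f (Some a) a)^* -
       F f (Some a) a * (F f (Some b) b)^* - F f (Some b) b * (F f (Some a) a)^* +
       F f (Some b) b * (F f (Some b) b)^*)).
      by apply: eq_bigr => g _; rewrite normCK rmorphB /=; ring.
    by rewrite big_split !sumrB /= !FF !eqxx; ring.
  move/psumr_eq0P => /(_ (fun f _ => exprn_ge0 2 (normr_ge0 _)) f isT)/eqP.
  by rewrite expf_eq0 normr_eq0 /= subr_eq0 => /eqP.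
exists (fun l k => F (l, k) (Some a0) a0) => [l k z a|].
  change (F (l, k) z a = F (l, k) (Some a0) a0 * (z == Some a)%:R).
  have [->|za] := eqVneq z (Some a); first by rewrite mulr1; apply: Fc.
  by rewrite F0 // mulr0.
rewrite pair_bigA /=; have := FF a0 a0 (Some a0) (Some a0).
rewrite eqxx mulr1; apply: etrans; apply: eq_bigr => -[l k] _ /=; exact: normCK.
Qed.

(** The columns of the square root decompose [rho] into unnormalized pure states. *)
Lemma tr_sqrt {T : finType} (B rho : op R T) : psd rho ->
  tr (opM B rho) = \sum_a dot ((psd_sqrt rho)^~ a) (app B ((psd_sqrt rho)^~ a)).
Proof.
move=> /psd_sqrtP[/psd_hermitian Ph PP].
rewrite -{1}PP; set P := psd_sqrt rho in Ph *.
rewrite /dot exchange_big; apply: eq_bigr => x _ /=.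
rewrite /opM; under eq_bigr do rewrite mulr_sumr.
rewrite exchange_big; apply: eq_bigr => a _ /=.
by rewrite mulr_sumr; apply: eq_bigr => y _; rewrite -Ph; ring.
Qed.

Lemma tr_gram_sqrt {T : finType} (B rho : op R T) : psd rho ->
  tr (opM (opM (adj B) B) rho) =
  \sum_a dot (app B ((psd_sqrt rho)^~ a)) (app B ((psd_sqrt rho)^~ a)).
Proof.
move=> /tr_sqrt->; apply: eq_bigr => a _.
rewrite (eq_dot (fun _ => erefl) (app_opcomp _ _ _)) dot_app.
by apply: eq_dot => // x; apply: eq_bigr => y _; rewrite /adjoint /adj conjCK.
Qed.

(** Nonnegativity of the variance: Cauchy-Schwarz over the columns of the square root, whose squared
    norms sum to the trace 1. *)
Lemma expectation_sq_le {T : finType} (B rho : op R T) : state rho ->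
  `|tr (opM B rho)| ^+ 2 <= tr (opM (opM (adj B) B) rho).
Proof.
case=> rp r1; rewrite tr_gram_sqrt // (tr_sqrt _ rp).
apply: le_trans (cauchy_schwarz_sum _ _) _.
suff -> : \sum_a dot ((psd_sqrt rho)^~ a) ((psd_sqrt rho)^~ a) = 1.
  by rewrite mul1r.
have idE (v : T -> C) : app (fun x y : T => (x == y)%:R) v =1 v.
  move=> x; rewrite /app (bigD1 x) //= eqxx mul1r big1 ?addr0 // => y.
  by rewrite eq_sym => /negPf->; rewrite mul0r.
rewrite -r1; transitivity (tr (opM (fun x y : T => (x == y)%:R) rho)).
  by rewrite tr_sqrt //; apply: eq_bigr => a _; apply: eq_dot => // x; rewrite idE.
by apply: eq_bigr => x _; rewrite [LHS](idE (rho^~ x) x).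
Qed.

Lemma tr_opMDr {T : finType} (A B1 B2 : op R T) :
  tr (opM A (opD B1 B2)) = tr (opM A B1) + tr (opM A B2).
Proof.
rewrite /tr -big_split; apply: eq_bigr => x _ /=; rewrite /opM -big_split.
by apply: eq_bigr => y _ /=; rewrite /opD mulrDr.
Qed.

Lemma tr_opMZr {T : finType} (A B : op R T) c :
  tr (opM A (opZ c B)) = c * tr (opM A B).
Proof.
rewrite /tr mulr_sumr; apply: eq_bigr => x _; rewrite /opM mulr_sumr.
by apply: eq_bigr => y _; rewrite /opZ; ring.
Qed.

Lemma tr_opMNr {T : finType} (A B : op R T) :
  tr (opM A (opN B)) = - tr (opM A B).
Proof.
rewrite -mulN1r -tr_opMZr; congr (tr (opM _ _)).
by apply: op_ext => x y; rewrite /opN /opZ mulN1r.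
Qed.

(** * The gap between two expectations and the variance in the mixture *)

Definition mixture {T : finType} (rho0 rho1 : op R T) : op R T :=
  opZ 2^-1 (opD rho0 rho1).

Lemma mixture_state {T : finType} (rho0 rho1 : op R T) :
  state rho0 -> state rho1 -> state (mixture rho0 rho1).
Proof.
move=> [/psdP p0 t0] [/psdP p1 t1]; split.
  apply/psdP => v.
  have -> : dot v (app (mixture rho0 rho1) v) =
      2^-1 * (dot v (app rho0 v) + dot v (app rho1 v)).
    rewrite /dot -big_split mulr_sumr; apply: eq_bigr => x _ /=.
    rewrite -mulrDr mulrCA; congr (_ * _); rewrite /app -big_split mulr_sumr.
    by apply: eq_bigr => y _; rewrite /mixture /opZ /opD /=; ring.
  by rewrite mulr_ge0 ?invr_ge0 ?ler0n // addr_ge0.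
rewrite /tr /mixture /opZ /opD -mulr_sumr big_split /=.
by rewrite -/(tr rho0) -/(tr rho1) t0 t1 mulVf // pnatr_eq0.
Qed.

(* The right-hand side is the second moment of [A] around [kappa] in the
   mixture, so this is the between-group part of its variance. *)
Lemma gap_le_variance {T : finType} (A rho0 rho1 : op R T) (kappa : C) :
  state rho0 -> state rho1 ->
  let s := psd_sqrt (mixture rho0 rho1) in
  let B : op R T := fun x y => A x y - kappa * (x == y)%:R in
  `|tr (opM A rho0) - tr (opM A rho1)| ^+ 2 <=
  4 * \sum_a dot (app B (s^~ a)) (app B (s^~ a)).
Proof.
move=> s0 s1; cbv zeta; set B := (B in app B); have [mp _] := mixture_state s0 s1.
rewrite -(tr_gram_sqrt _ mp) tr_opMZr tr_opMDr.
have h0 := expectation_sq_le B s0; have h1 := expectation_sq_le B s1.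
have trB rho : state rho -> tr (opM B rho) = tr (opM A rho) - kappa.
  case=> _ r1; rewrite -[kappa]mulr1 -r1 /tr mulr_sumr -sumrB.
  apply: eq_bigr => x _; rewrite /opM /B.
  under eq_bigr do rewrite mulrBl.
  rewrite sumrB; congr (_ - _); rewrite (bigD1 x) //= eqxx big1 ?addr0 ?mulr1 // => y.
  by rewrite eq_sym => /negPf->; rewrite mulr0 mul0r.
(* Subtracting [kappa] times the identity shifts both expectations equally. *)
have -> : tr (opM A rho0) - tr (opM A rho1) = tr (opM B rho0) - tr (opM B rho1).
  by rewrite !trB //; ring.
rewrite mulrA (_ : 4 * 2^-1 = 2) ; last by field.
(* Parallelogram law: |u - v|^2 <= 2 (|u|^2 + |v|^2). The 2 is 4 times the weight 1/2 in the
   mixture. *)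
apply: (@le_trans _ _ (2 * (`|tr (opM B rho0)| ^+ 2 + `|tr (opM B rho1)| ^+ 2))).
  rewrite -subr_ge0.
  set u := tr (opM B rho0); set v := tr (opM B rho1).
  suff -> : 2 * (`|u| ^+ 2 + `|v| ^+ 2) - `|u - v| ^+ 2 = `|u + v| ^+ 2.
    by rewrite exprn_ge0.
  by rewrite !normCK rmorphB rmorphD /=; ring.
by rewrite ler_pM2l ?ltr0n // lerD.
Qed.

Lemma tr_rank_one {T : finType} (Q : op R T) (u v : T -> C) :
  tr (opM Q (fun p q => u p * (v q)^*)) = dot v (app Q u).
Proof.
apply: eq_bigr => p _; rewrite /opM mulr_sumr; apply: eq_bigr => q _; ring.
Qed.

(** * The projector testing for a disturbed message *)

Section TestOperator.
Variables (M : finType) (s : prodF M M -> C).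
Hypothesis s1 : dot s s = 1.

Definition ext_vec (p : prodF (optF M) M) : C :=
  if p.1 is Some x then s (x, p.2) else 0.

(* The projector onto the complement of [s] in [M (x) M], extended by 0 on the
   states with first component bot. *)
Definition test_op : op R (prodF (optF M) M) := fun p q =>
  (isSome p.1 && (p == q))%:R - ext_vec p * (ext_vec q)^*.

Lemma dot_ext_vec v : dot ext_vec v = \sum_a \sum_x (s (x, a))^* * v (Some x, a).
Proof.
rewrite /dot sum_pair exchange_big; apply: eq_bigr => a _ /=.
by rewrite sum_option /ext_vec /= conjC0 mul0r add0r.
Qed.

Lemma ext_vec1 : dot ext_vec ext_vec = 1.
Proof. by rewrite dot_ext_vec -s1 /dot sum_pair exchange_big. Qed.

Lemma app_test v p :
  app test_op v p = (isSome p.1)%:R * v p - dot ext_vec v * ext_vec p.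
Proof.
rewrite /app /test_op; under eq_bigr do rewrite mulrBl -mulrA.
rewrite sumrB -mulr_sumr [ext_vec p * _]mulrC; congr (_ - _).
rewrite (bigD1 p) //= eqxx andbT big1 ?addr0 // => q.
by rewrite eq_sym => /negPf->; rewrite andbF mul0r.
Qed.

Let proj (v : prodF (optF M) M -> C) p := (isSome p.1)%:R * v p.

Lemma dot_proj_ext v : dot ext_vec (proj v) = dot ext_vec v.
Proof.
apply: eq_bigr => -[[x|] a] _; rewrite /proj /= ?mul1r //.
by rewrite /ext_vec /= conjC0 !mul0r.
Qed.

Lemma app_test_proj v :
  app test_op v =1 fun p => proj v p - dot ext_vec (proj v) * ext_vec p.
Proof. by move=> p; rewrite app_test dot_proj_ext. Qed.

(** [test_op] is an orthogonal projector, so its quadratic form is a squared norm. *)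
Lemma dot_test v : dot v (app test_op v) = dot (app test_op v) (app test_op v).
Proof.
rewrite [RHS](eq_dot (app_test_proj v) (app_test_proj v)) (dot_proj _ ext_vec1).
have E p : app test_op v p = proj v p + - dot ext_vec v * ext_vec p.
  by rewrite app_test mulNr.
rewrite (eq_dot (fun _ => erefl) E) dot_linr dot_proj_ext -[dot v ext_vec]dotC.
rewrite normCK mulNr; congr (_ - _); apply: eq_bigr => p _.
by rewrite /proj; case: (isSome _); rewrite ?mul1r // mul0r conjC0 mulr0 mul0r.
Qed.

Lemma test_contraction v : dot (app test_op v) (app test_op v) <= dot v v.
Proof.
rewrite (eq_dot (app_test_proj v) (app_test_proj v)) (dot_proj _ ext_vec1).
apply: (@le_trans _ _ (dot (proj v) (proj v))).
  by rewrite lerBlDr lerDl exprn_ge0.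
rewrite !dotvv; apply: ler_sum => p _; rewrite /proj.
by case: (isSome _); rewrite ?mul1r // mul0r normr0 expr0n exprn_ge0.
Qed.

Lemma test_hermitian : adj test_op = test_op.
Proof.
apply: op_ext => p q; rewrite /adj /test_op rmorphB rmorphM /= conjCK conjC_nat.
congr (_%:R - _); last by rewrite mulrC.
by rewrite [q == p]eq_sym; case: eqVneq => [->|]; rewrite ?andbF.
Qed.

(** The test annihilates [s]. With [tr_test_bot] this removes the whole ideal output of the security
    condition, whatever the value of [p]. *)
Lemma tr_test_embed1 :
  tr (opM test_op (embed1 (fun p q => s p * (s q)^*))) = 0.
Proof.
have -> : embed1 (fun p q : prodF M M => s p * (s q)^*) =
    fun p q => ext_vec p * (ext_vec q)^*.
  apply: op_ext => -[[x|] a] [[y|] b]; rewrite /embed1 /ext_vec /= ?mul0r //.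
  by rewrite conjC0 mulr0.
rewrite tr_rank_one; apply: big1 => -[[x|] a] _.
  by rewrite app_test ext_vec1 /= !mul1r subrr mulr0.
by rewrite {1}/ext_vec conjC0 mul0r.
Qed.

Lemma tr_test_bot tau : tr (opM test_op (bot_tens tau)) = 0.
Proof.
apply: big1 => -[x a] _; apply: big1 => -[y b] _ /=.
rewrite /bot_tens /test_op /=; case: y => [y|]; first by rewrite mulr0.
case: x => [x|]; first by rewrite mulr0.
by rewrite /ext_vec /= mul0r subr0 mul0r.
Qed.

End TestOperator.

(** * The pulled back observable and its dispersion *)

Lemma tens_id_kraus {K T U A : finType} (G : K -> U -> T -> C) (Phi : qmap R T U)
    (s : T -> A -> C) : kraus G Phi ->
  tens_id Phi (fun p q => s p.1 p.2 * (s q.1 q.2)^*) =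
  fun p q => \sum_k app (G k) (s^~ p.2) p.1 * (app (G k) (s^~ q.2) q.1)^*.
Proof.
move=> kG; apply: op_ext => p q; rewrite /tens_id kG; apply: eq_bigr => k _ /=.
rewrite /app rmorph_sum big_distrlr pair_bigA /=.
by apply: eq_bigr => r _; rewrite rmorphM /=; ring.
Qed.

(** Cauchy-Schwarz in each coordinate [x] against the unit vector [c]. *)
Lemma unit_combination_le {I T : finType} (c : I -> C) (q : I -> T -> C) :
  \sum_i `|c i| ^+ 2 = 1 ->
  dot (fun x => \sum_i (c i)^* * q i x) (fun x => \sum_i (c i)^* * q i x)
    <= \sum_i dot (q i) (q i).
Proof.
move=> c1; rewrite dotvv; under [leRHS]eq_bigr do rewrite dotvv.
rewrite exchange_big; apply: ler_sum => x _ /=.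
apply: le_trans (cauchy_schwarz c (q^~ x)) _.
by rewrite !dotvv c1 mul1r.
Qed.

(* [\sum_k E_k^* V E_k]: the adjoint channel applied to the observable [V]. *)
Definition pullback {K N M : finType} (E : K -> N -> M -> C) (V : op R N) : op R M :=
  fun a b => \sum_k dot ((E k)^~ a) (app V ((E k)^~ b)).

Lemma tr_pullback {K N M : finType} (E : K -> N -> M -> C) Enc (V : op R N) rho :
  kraus E Enc -> tr (opM V (Enc rho)) = tr (opM (pullback E V) rho).
Proof.
move=> kE.
transitivity (\sum_k \sum_(p : M * M) \sum_(q : N * N)
   (E k q.1 p.2)^* * V q.1 q.2 * E k q.2 p.1 * rho p.1 p.2).
  rewrite /tr /opM pair_bigA /=.
  under eq_bigr do rewrite kE mulr_sumr.
  rewrite exchange_big; apply: eq_bigr => k _ /=.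
  under eq_bigr do rewrite mulr_sumr.
  rewrite exchange_big; apply: eq_bigr => p _; apply: eq_bigr => q _ /=; ring.
rewrite /tr /opM [RHS]exchange_big pair_bigA /= exchange_big.
apply: eq_bigr => p _ /=; rewrite /pullback mulr_suml; apply: eq_bigr => k _.
rewrite sum_pair /dot /app mulr_suml; apply: eq_bigr => x _.
by rewrite mulr_sumr mulr_suml; apply: eq_bigr => y _ /=; ring.
Qed.

(** The resolution of the identity sum_l D_l^* D_l = 1 is inserted between E_k^* and V E_k; as D_l
    E_k is a multiple of the embedding, only the row [Some a] survives. *)
Lemma decoded_pullback {K L N M : finType} (E : K -> N -> M -> C)
    (D : L -> optF M -> N -> C) (Dec : qmap R N (optF M)) (V : op R N) (c : L -> K -> C) :
  kraus D Dec -> trace_preserving Dec ->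
  (forall l k z a, opcomp (D l) (E k) z a = c l k * (z == Some a)%:R) ->
  forall a b, pullback E V a b =
    \sum_(f : L * K) (c f.1 f.2)^* *
      opcomp (D f.1) (opcomp V (E f.2)) (Some a) b.
Proof.
move=> kD tpD Dc a b; rewrite sum_pair exchange_big; apply: eq_bigr => k _ /=.
rewrite -(kraus_isometry kD tpD); apply: eq_bigr => l _.
rewrite /dot (bigD1 (Some a)) //= big1 => [|z /negPf za].
  by rewrite addr0 -/(opcomp (D l) (E k) (Some a) a) Dc eqxx mulr1.
by rewrite -/(opcomp (D l) (E k) z a) Dc za mulr0 conjC0 mul0r.
Qed.

Lemma ptrace_but_hermitian (t : nat) (S : 'I_t -> finType) (i : 'I_t)
    (A : op R (joint S)) : (forall x y, A y x = (A x y)^*) ->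
  forall x y, ptrace_but i A y x = (ptrace_but i A x y)^*.
Proof.
move=> hA x y; rewrite /ptrace_but rmorph_sum.
rewrite (exchange_big_dep (fun b : joint S => b i == x)) => [/=|a b _ /andP[] //].
apply: eq_bigr => b bx; rewrite rmorph_sum /=.
apply: eq_big => [a|a _]; last exact: hA.
by rewrite bx; congr (_ && _); apply: eq_forallb => j; rewrite [a j == _]eq_sym.
Qed.

Lemma kraus_hermitian {K T U : finType} (E : K -> U -> T -> C) Phi (rho : op R T) :
  kraus E Phi -> (forall x y, rho y x = (rho x y)^*) ->
  forall x y, Phi rho y x = (Phi rho x y)^*.
Proof.
move=> kE hr x y; rewrite !kE rmorph_sum; apply: eq_bigr => k _ /=.
rewrite rmorph_sum !sum_pair exchange_big.
apply: eq_bigr => a _; apply: eq_bigr => b _ /=.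
by rewrite !rmorphM /= conjCK -hr; ring.
Qed.

Lemma share_op_unitary_CPTP (t : nat) (S : 'I_t -> finType) (i : 'I_t) (U : op R (S i)) :
  (forall x y, opM (adj U) U x y = (x == y)%:R) ->
  forall j, CPTP (conj_map
    (dfwith (fun j => (fun x y : S j => (x == y)%:R) : op R (S j)) U j)).
Proof.
move=> UU j; apply: conj_map_CPTP; have [<-|ij] := eqVneq i j.
  by rewrite dfwith_in.
rewrite dfwith_out // => x y; rewrite /opM /adj (bigD1 x) //= eqxx conjC_nat mul1r.
by rewrite big1 ?addr0 // => z /negPf->; rewrite conjC_nat mul0r.
Qed.

(* The pulled back observable is nearly dispersion-free: tampering with [V]
   leaves the decoded state close to a mixture of the message and bot, so by the
   Cauchy-Schwarz inequality the component of [(T (x) 1) s] orthogonal to [s]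
   is small. *)
Lemma pullback_gap (K L M N : finType) (E : K -> N -> M -> C)
    (D : L -> optF M -> N -> C) (Enc : qmap R M N) (Dec : qmap R N (optF M))
    (Lam : qmap R N N) (V : op R N) (p eps : R) (rho0 rho1 : op R M) :
  kraus E Enc -> kraus D Dec -> kraus (fun _ : unit => V) Lam ->
  trace_preserving Dec -> (forall rho, Dec (Enc rho) = embed rho) ->
  state rho0 -> state rho1 ->
  let sMM := canon_purif (mixture rho0 rho1) in
  tnorm (opD (tens_id (fun rho => Dec (Lam (Enc rho))) sMM)
    (opN (opD (opZ (p%:C)%C (embed1 sMM))
              (opZ ((1 - p)%:C)%C (bot_tens (ptrace1 sMM)))))) <= eps ->
  `|tr (opM V (Enc rho0)) - tr (opM V (Enc rho1))| ^+ 2 <= (4 * eps)%:C%C.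
Proof.
move=> kE kD kV tpD DE st0 st1 sMM; set X := opD _ _ => Xeps.
(* A state has trace 1, so the message type is inhabited; [decoder_kraus] takes an element. *)
have [a0 _|M0] := pickP (mem M); last first.
  have [_] := st0; rewrite /tr big1 => [/esym/eqP|x _]; last by have := M0 x.
  by rewrite oner_eq0.
have [mp m1] := mixture_state st0 st1.
have [c Dc c1] := decoder_kraus a0 kE kD DE.
set P := psd_sqrt (mixture rho0 rho1) in sMM X Xeps *.
pose s (q : prodF M M) : C := P q.1 q.2.
have s1 : dot s s = 1.
  rewrite -m1; have [/psd_hermitian Ph PP] := psd_sqrtP mp.
  rewrite -PP -/P /dot sum_pair; apply: eq_bigr => x _; apply: eq_bigr => y _ /=.
  by rewrite /s /= -Ph mulrC.
pose G (f : L * K) := opcomp (D f.1) (opcomp V (E f.2)).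
(* The unnormalized branches of the tampered decoding of [s], one for each Kraus operator. *)
pose g f (q : prodF (optF M) M) := app (G f) (P^~ q.2) q.1.
have kG : kraus G (fun rho => Dec (Lam (Enc rho))).
  have kVE : kraus (fun k => opcomp V (E k)) (fun rho => Lam (Enc rho)).
    by move=> rho x y; rewrite (kraus_comp kE kV) sum_pair sum_unit.
  exact: kraus_comp kVE kD.
pose Q := test_op s.
(* The ideal part has trace zero against [Q], so only the branches remain. *)
have trX : tr (opM Q X) = \sum_f dot (app Q (g f)) (app Q (g f)).
  rewrite /X tr_opMDr tr_opMNr tr_opMDr !tr_opMZr tr_test_bot.
  rewrite (tr_test_embed1 s1) !mulr0 addr0 subr0 (tens_id_kraus P kG).
  transitivity (\sum_f tr (opM Q (fun p q => g f p * (g f q)^*))).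
    rewrite exchange_big; apply: eq_bigr => q _ /=.
    rewrite exchange_big; apply: eq_bigr => r _ /=; exact: mulr_sumr.
  by apply: eq_bigr => f _; rewrite tr_rank_one (dot_test s1).
have Qeps : \sum_f dot (app Q (g f)) (app Q (g f)) <= eps%:C%C.
  rewrite -trX; apply: le_trans (real_ler_norm _) _.
    by rewrite trX ger0_real // sumr_ge0 // => f _; rewrite dot_ge0.
  apply: le_trans (tnorm_dual X (test_hermitian s) (test_contraction s1)) _.
  by rewrite lecR.
(* This is the expectation of the pulled back observable in the mixture; subtracting it there
   corresponds to removing the component along [s] from the branches. *)
pose kappa := \sum_f (c f.1 f.2)^* * dot (ext_vec s) (g f).
rewrite !(tr_pullback V _ kE).
apply: le_trans (gap_le_variance (pullback E V) kappa st0 st1) _.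
rewrite rmorphM rmorph_nat ler_pM2l ?ltr0n //; apply: le_trans Qeps.
have cf1 : \sum_(f : L * K) `|c f.1 f.2| ^+ 2 = 1 by rewrite -c1 pair_bigA.
apply: le_trans (unit_combination_le (fun f => app Q (g f)) cf1).
rewrite -/P [leRHS]dotvv sum_pair [leRHS]exchange_big; apply: ler_sum => a _ /=.
(* The bot component of the combined branches is dropped; on the message components the two vectors
   agree entrywise. *)
rewrite sum_option dotvv; apply: ler_wpDl; first by rewrite exprn_ge0.
apply: ler_sum => x _; rewrite le_eqVlt; apply/orP; left; apply/eqP.
congr (`|_| ^+ 2).
under [RHS]eq_bigr do rewrite app_test mulrBr mulrA [X in _ - X]mulrA.
rewrite sumrB /= -[in X in _ - X]mulr_suml -/kappa.
rewrite /app; under [LHS]eq_bigr do rewrite mulrBl.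
rewrite sumrB; congr (_ - _).
  under [LHS]eq_bigr do rewrite (decoded_pullback V kD tpD Dc) mulr_suml.
  rewrite exchange_big; apply: eq_bigr => f _ /=.
  by rewrite mulr1 /g /app mulr_sumr; apply: eq_bigr => y _; rewrite mulrA.
rewrite (bigD1 x) //= eqxx mulr1 big1 ?addr0 // => y.
by rewrite eq_sym => /negPf->; rewrite mulr0 mul0r.
Qed.

End Tampering.

(** * Single-share encryption *)

Theorem theorem9p1 (R : realType) (M : finType) (t : nat) (S : 'I_t -> finType)
    (Enc : qmap R M (joint S)) (Dec : qmap R (joint S) (optF M)) (eps : R) :
  quantum_code Enc Dec ->
  tamper_detection_LO Enc Dec eps ->
  forall psi0 psi1 : op R M, state psi0 -> state psi1 ->
  forall i : 'I_t,
    tnorm (opD (ptrace_but i (Enc psi0)) (opN (ptrace_but i (Enc psi1))))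
      <= 4 * Num.sqrt eps.
Proof.
move=> [[Encl Enccp Enctp] [Decl Deccp Dectp] DE] secure psi0 psi1 st0 st1 i.
have [K [E kE]] := choi_kraus Encl Enccp.
have [L [D kD]] := choi_kraus Decl Deccp.
set X := opD _ _.
have Xh x y : X y x = (X x y)^*.
  rewrite /X /opD /opN rmorphD rmorphN /=.
  by congr (_ - _); apply/ptrace_but_hermitian/(kraus_hermitian kE);
    apply: psd_hermitian; case: st0 st1 => ? _ [].
have [U UU XU] := tnorm_hermitian_unitary Xh.
(* Security is used for one tampering, [U] on share [i], and one message state, the equal
   mixture. *)
have [p [_ /(_ _ (mixture_state st0 st1)) Hp]] := secure _ (share_op_unitary_CPTP UU).
have := pullback_gap kE kD (tens_maps_conj _) Dectp DE st0 st1 Hp.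
rewrite -/(share_op U).
have -> : tr (opM (share_op U) (Enc psi0)) - tr (opM (share_op U) (Enc psi1)) =
    tr (opM U X).
  by rewrite /X tr_opMDr tr_opMNr !tr_ptrace_but.
move=> gap.
have [_ X0] := tnormE X.
have : (tnorm X)%:C%C ^+ 2 <= (4 * eps)%:C%C.
  apply: le_trans gap; rewrite lerXn2r ?nnegrE ?normr_ge0 //.
  by rewrite ger0_norm // (le_trans X0 XU).
rewrite -rmorphXn lecR => X2; rewrite ler0c in X0.
rewrite -(ger0_norm X0) -sqrtr_sqr; apply: le_trans (ler_wsqrtr X2) _.
(* Here sqrt 4 is bounded by 4, being at most the square root of 16; this relaxes 2 sqrt eps to the
   stated bound. *)
rewrite sqrtrM ?ler0n // ler_wpM2r ?sqrtr_ge0 //.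
by rewrite -[X in _ <= X]ger0_norm // -sqrtr_sqr ler_wsqrtr // expr2 -natrM ler_nat.
Qed.
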